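(* Let $N\ge1$ and $0\le K\le N$ be integers and let $S$ be a 2-string with $|S|=2K$. Then $$\lim_{x_N\to\infty}H_S(x_1,\dots,x_{N-1},x_N;\bm{z})=\begin{cases}H_S(x_1,\dots,x_{N-1};\bm{z}),& |S|\le 2N-2,\\ 0,&\text{otherwise (i.e. } |S|=2N).\end{cases}$$
   Context: **Weights.** All parameters ($q$ and the spectral parameters) are generic/indeterminates. For $i,j,k,\ell\in\{0,1,2\}$ the Izergin--Korepin vertex weight $W_{y/x}(i,j;k,\ell)$ ($i$ = bottom incoming state, $j$ = left incoming state, $k$ = top outgoing state, $\ell$ = right outgoing state; $x$ = parameter of the horizontal line, $y$ = parameter of the vertical line) depends on $x,y$ only through $y/x$, and, with $D=(x-q^2y)(x-q^3y)$, is given by $W(0,0;0,0)=W(2,2;2,2)=1$; $W(1,0;1,0)=W(2,1;2,1)=\frac{q^2(x-y)}{x-q^2y}$; $W(1,0;0,1)=W(2,1;1,2)=\frac{(1-q^2)x}{x-q^2y}$; $W(0,1;1,0)=W(1,2;2,1)=\frac{(1-q^2)y}{x-q^2y}$; $W(0,1;0,1)=W(1,2;1,2)=\frac{x-y}{x-q^2y}$; $W(2,0;2,0)=\frac{q^4(x-y)(x-qy)}{D}$; $W(2,0;1,1)=-\frac{q(1-q)^2(1+q)x(x-y)}{D}$; $W(2,0;0,2)=\frac{(1-q^2)x(x+qx-qy-q^3y)}{D}$; $W(1,1;2,0)=-\frac{q^4(1+q)(x-y)y}{D}$; $W(1,1;1,1)=\frac{-qx^2+(1+q)(1-q^2+q^4)xy-q^4y^2}{D}$;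 $W(1,1;0,2)=\frac{(1+q)x(x-y)}{D}$; $W(0,2;2,0)=\frac{(1-q^2)(x+q^2x-q^2y-q^3y)y}{D}$; $W(0,2;1,1)=\frac{q(1-q)^2(1+q)(x-y)y}{D}$; $W(0,2;0,2)=\frac{(x-y)(x-qy)}{D}$; and $W=0$ in all other cases. **2-strings.** A 2-string is an infinite vector $S=(S_1,S_2,\dots)$ with $S_i\in\{0,1,2\}$ and only finitely many nonzero entries; $|S|=\sum_i S_i$. $\bm{z}=(z_1,z_2,\dots)$. **$F_S^I$.** For $I=(I_1,\dots,I_N)\in\{0,1,2\}^N$ with $|I|=\sum_r I_r=|S|$, choose $L$ with $S_c=0$ for $c>L$ and put $$F_S^I(x_1,\dots,x_N;\bm{z})=\sum\prod_{r=1}^{N}\prod_{c=1}^{L}W_{z_c/x_r}(v_{r-1,c},h_{r,c-1};v_{r,c},h_{r,c}),$$ summed over all $h_{r,c}\in\{0,1,2\}$ ($1\le r\le N$, $0\le c\le L$) and $v_{r,c}\in\{0,1,2\}$ ($0\le r\le N$, $1\le c\le L$) with $h_{r,0}=I_r$, $h_{r,L}=0$, $v_{0,c}=0$, $v_{N,c}=S_c$ (independent of $L$). **$H_S$.** For $0\le K\le N$ and $|S|=2K$, $$H_S(x_1,\dots,x_N;\bm{z})=\sum_{I\in\{0,1,2\}^N:\,|I|=2K}(-1)^{\mathfrak{c}_1(I)/2}(1-q^{-1})^{\mathfrak{c}_1(I)}q^{-\mathrm{inv}(I)}F_S^I(x_1,\dots,x_N;\bm{z}),$$ where $\mathfrak{c}_1(I)=\#\{r:I_r=1\}$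 and $\mathrm{inv}(I)=\sum_{1\le i<j\le N}I_i(2-I_j)$. For the empty primary alphabet, $H_{(0,0,\dots)}=1$. *)

(* Defs.v *)
From HB Require Import structures.
From mathcomp Require Import all_boot all_order all_algebra finmap.
From mathcomp Require Import all_classical all_reals all_analysis.

Set Implicit Arguments.
Unset Strict Implicit.
Unset Printing Implicit Defensive.

Import Order.TTheory GRing.Theory Num.Theory.
Import numFieldNormedType.Exports.

Local Open Scope classical_set_scope.
Local Open Scope ring_scope.

(** Edge states are elements of ['I_3] = {0, 1, 2}.  Rows, columns and the
    infinite families [z] and [S] are indexed from 0 instead of 1. *)

(** [x] is the parameter of the horizontal line, [y] that of the vertical line;
    [i] enters from the bottom, [j] from the left, [k] leaves at the top and
    [l] at the right. *)
Definition ik_weight (F : fieldType) (q x y : F) (i j k l : nat) : F :=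
  let d := x - q ^+ 2 * y in
  let D := (x - q ^+ 2 * y) * (x - q ^+ 3 * y) in
  match i, j, k, l with
  | 0%N, 0%N, 0%N, 0%N | 2%N, 2%N, 2%N, 2%N => 1
  | 1%N, 0%N, 1%N, 0%N | 2%N, 1%N, 2%N, 1%N => q ^+ 2 * (x - y) / d
  | 1%N, 0%N, 0%N, 1%N | 2%N, 1%N, 1%N, 2%N => (1 - q ^+ 2) * x / d
  | 0%N, 1%N, 1%N, 0%N | 1%N, 2%N, 2%N, 1%N => (1 - q ^+ 2) * y / d
  | 0%N, 1%N, 0%N, 1%N | 1%N, 2%N, 1%N, 2%N => (x - y) / d
  | 2%N, 0%N, 2%N, 0%N => q ^+ 4 * (x - y) * (x - q * y) / D
  | 2%N, 0%N, 1%N, 1%N =>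
      - (q * (1 - q) ^+ 2 * (1 + q) * x * (x - y) / D)
  | 2%N, 0%N, 0%N, 2%N =>
      (1 - q ^+ 2) * x * (x + q * x - q * y - q ^+ 3 * y) / D
  | 1%N, 1%N, 2%N, 0%N => - (q ^+ 4 * (1 + q) * (x - y) * y / D)
  | 1%N, 1%N, 1%N, 1%N =>
      (- (q * x ^+ 2) + (1 + q) * (1 - q ^+ 2 + q ^+ 4) * x * y
       - q ^+ 4 * y ^+ 2) / D
  | 1%N, 1%N, 0%N, 2%N => (1 + q) * x * (x - y) / D
  | 0%N, 2%N, 2%N, 0%N =>
      (1 - q ^+ 2) * (x + q ^+ 2 * x - q ^+ 2 * y - q ^+ 3 * y) * y / D
  | 0%N, 2%N, 1%N, 1%N => q * (1 - q) ^+ 2 * (1 + q) * (x - y) * y / D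
  | 0%N, 2%N, 0%N, 2%N => (x - y) * (x - q * y) / D
  | _, _, _, _ => 0
  end.

Definition two_string := {fsfun nat -> 'I_3 with ord0}.

Definition ts_size (S : two_string) : nat := (\sum_(c <- finsupp S) S c)%N.

(** [L] columns suffice to carry the whole support of [S]. *)
Definition ts_fits (S : two_string) (L : nat) : Prop :=
  forall c : nat, (L <= c)%N -> S c = ord0.

(** [h r c] ([0 <= c <= L]) are the horizontal and [v r c] ([0 <= r <= N]) the
    vertical edges.  The vertex in row [r], column [c] (both from 0) has left
    edge [h r c], right edge [h r (c + 1)], bottom edge [v r c] and top edge
    [v (r + 1) c]: [widen_ord (leqnSn _)] keeps the value of an ordinal and
    [lift ord0] increases it by one. *)
Definition ik_F (F : fieldType) (q : F) (z : nat -> F) (L N : nat)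
    (S : two_string) (I : N.-tuple 'I_3) (x : N.-tuple F) : F :=
  \sum_(h : 'M['I_3]_(N, L.+1) |
      [forall r, (h r ord0 == tnth I r) && (h r ord_max == ord0)])
  \sum_(v : 'M['I_3]_(N.+1, L) |
      [forall c : 'I_L, (v ord0 c == ord0) && (v ord_max c == S c)])
    \prod_(r < N) \prod_(c < L)
      ik_weight q (tnth x r) (z c)
        (v (widen_ord (leqnSn N) r) c) (h r (widen_ord (leqnSn L) c))
        (v (lift ord0 r) c) (h r (lift ord0 c)).

Definition state_size (N : nat) (I : N.-tuple 'I_3) : nat :=
  (\sum_(r < N) tnth I r)%N.

Definition state_c1 (N : nat) (I : N.-tuple 'I_3) : nat :=
  #|[pred r : 'I_N | tnth I r == 1%N :> nat]|.

Definition state_inv (N : nat) (I : N.-tuple 'I_3) : nat :=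
  (\sum_(i < N) \sum_(j < N | i < j) tnth I i * (2 - tnth I j))%N.

(** Meant for [ts_size S] even, which makes [state_c1 I] even in each term. *)
Definition ik_H (F : fieldType) (q : F) (z : nat -> F) (L N : nat)
    (S : two_string) (x : N.-tuple F) : F :=
  \sum_(I : N.-tuple 'I_3 | state_size I == ts_size S)
    (-1) ^+ (state_c1 I)./2 * (1 - q^-1) ^+ state_c1 I * q ^- state_inv I
    * ik_F q z L S I x.

Lemma ik_H_empty (F : fieldType) (q : F) (z : nat -> F) (L : nat)
    (S : two_string) (x : 0.-tuple F) :
  (forall c, S c = ord0) -> ik_H q z L S x = 1.
Proof.
move=> S0; rewrite /ik_H (big_pred1 [tuple]); last first.
  move=> I; rewrite /state_size /ts_size big_ord0 big1 => [|c _].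
    by rewrite [I]tuple0; apply/esym/eqP.
  by rewrite S0.
rewrite /state_c1 /state_inv big_ord0 eq_card0; last by case.
rewrite !expr0 invr1 !mul1r /ik_F.
rewrite (big_pred1 (const_mx ord0)); last first.
  move=> h; have -> : h = const_mx ord0 by apply/matrixP => -[].
  by rewrite [RHS]eqxx; apply/forallP => -[].
rewrite (big_pred1 (const_mx ord0)) ?big_ord0// => v.
apply/forallP/eqP => [v0|-> c]; last by rewrite !mxE S0 eqxx.
apply/matrixP => r c; rewrite mxE ord1.
by have /andP[/eqP] := v0 c.
Qed.

(** The filter [|t| -> +oo]; over the complex numbers, the punctured
    neighbourhoods of the point at infinity. *)
Definition infty_nbhs (C : numFieldType) : set_system C :=
  fun P => exists M : C, M \is Num.real /\ forall t : C, M < `|t| -> P t.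
Arguments infty_nbhs C : clear implicits.

#[global] Instance infty_nbhs_proper (C : numFieldType) :
  ProperFilter (infty_nbhs C).
Proof.
split; last split.
- case=> M [Mr] /(_ (`|M| + 1)); apply.
  by rewrite ger0_norm ?addr_ge0// ltr_pwDr// real_ler_norm.
- by exists 0; split.
- move=> P Q [M [Mr MP]] [M' [Mr' MQ]].
  exists (Num.max M M'); split; first exact: max_real.
  move=> t; rewrite comparable_gt_max ?real_comparable// => /andP[tM tM'].
  by split; [exact: MP | exact: MQ].
- by move=> P Q PQ [M [Mr MP]]; exists M; split=> // t /MP /PQ.
Qed.

(* Main.v *)
Require Import Defs.
From HB Require Import structures.
From mathcomp Require Import all_boot all_order all_algebra finmap.
From mathcomp Require Import all_classical all_reals all_analysis.
From mathcomp Require Import ring zify.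

Set Implicit Arguments.
Unset Strict Implicit.
Unset Printing Implicit Defensive.

Import Order.TTheory GRing.Theory Num.Theory.
Import numFieldNormedType.Exports.

Local Open Scope classical_set_scope.
Local Open Scope ring_scope.

(** The weight [ik_weight q x y] depends on [y / x] only, so that sending the
    parameter [x = t] of the top row to infinity replaces its weights by
    [ik_weight q 1 0].  A nonvanishing limit weight never has a right edge
    smaller than its left edge ([ik_weight_inf_ndecr]).  Since the rightmost
    edge of the top row is 0, all its horizontal edges are 0; by conservation
    of [i + j = k + l] the states then cross that row unchanged, each column
    [c] contributing [q ^+ (2 * S c)].

    Hence in the limit the top row forces the last entry of [I] to be 0 and
    multiplies [F] by [q ^+ (2 * |S|)].  Appending a 0 to [I] leaves
    [state_c1 I] unchanged and increases [state_inv I] by [2 * |I|], where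
    [|I| = |S|], so the two powers of [q] cancel and [H] tends to the same sum
    over one row less ([cvg_ik_H]).  If [|S|] exceeds twice the number of
    remaining rows that sum is empty ([ik_H_eq0]).

    The number of columns is immaterial as soon as it covers the support of
    [S] ([ik_H_indep]): by conservation, a last column with both outer vertical
    edges and all right edges equal to 0 is entirely 0. *)

(** * The vertex weights and their limit *)

Lemma ik_weight_scale (F : fieldType) (q a x y : F) (i j k l : nat) :
  a != 0 -> ik_weight q (a * x) (a * y) i j k l = ik_weight q x y i j k l.
Proof.
move=> a0; rewrite /ik_weight.
have e n : a * x - q ^+ n * (a * y) = a * (x - q ^+ n * y) by ring.
rewrite !e !invfM.
(* The identity also holds where these denominators vanish: their inverses are
   treated as arbitrary elements. *)
move: (x - q ^+ 2 * y)^-1 (x - q ^+ 3 * y)^-1 => d d'.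
by case: i => [|[|[|i]]] //; case: j => [|[|[|j]]] //;
  case: k => [|[|[|k]]] //; case: l => [|[|[|l]]] //; field.
Qed.

Lemma ik_weight_conserve (F : fieldType) (q x y : F) (i j k l : nat) :
  ik_weight q x y i j k l != 0 -> (i + j = k + l)%N.
Proof.
by case: i => [|[|[|i]]] //; case: j => [|[|[|j]]] //;
  case: k => [|[|[|k]]] //; case: l => [|[|[|l]]] //; rewrite /ik_weight ?eqxx.
Qed.

(** At [x] infinite, horizontal states cannot decrease from left to right. *)
Lemma ik_weight_inf_ndecr (F : fieldType) (q : F) (i j k l : nat) :
  ik_weight q 1 0 i j k l != 0 -> (j <= l)%N.
Proof.
by case: i => [|[|[|i]]] //; case: j => [|[|[|j]]] //;
  case: k => [|[|[|k]]] //; case: l => [|[|[|l]]] //;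
  rewrite /ik_weight ?(mulr0, mul0r, oppr0) ?eqxx.
Qed.

Lemma ik_weight_inf_vert (F : fieldType) (q : F) (i : 'I_3) :
  ik_weight q 1 0 i 0 i 0 = q ^+ (2 * i).
Proof.
by case: i => [[|[|[|//]]]] i3;
  rewrite /ik_weight /= ?(mulr0, subr0, mulr1, divr1).
Qed.

Lemma cvg_inv_infty (C : numFieldType) :
  t^-1 @[t --> infty_nbhs C] --> (0 : C).
Proof.
apply/cvgr0Pnorm_lt => e e0; exists e^-1; split.
  by rewrite realE invr_ge0 ltW.
move=> t et; rewrite normfV -[e]invrK ltf_pV2 // posrE ?invr_gt0 //.
by rewrite (lt_trans _ et) ?invr_gt0.
Qed.

Lemma cvg_ik_weight0 (C : numFieldType) (T : Type) (G : set_system T)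
    (FG : Filter G) (f : T -> C) (q : C) (i j k l : nat) :
  f t @[t --> G] --> 0 ->
  ik_weight q 1 (f t) i j k l @[t --> G] --> ik_weight q 1 0 i j k l.
Proof.
move=> f0.
(* The limit rules restated pointwise, so that they match the syntax of the
   weights. *)
have mulW (a b : T -> C) (u v : C) : a @ G --> u -> b @ G --> v ->
  a t * b t @[t --> G] --> u * v by exact: cvgM.
have addW (a b : T -> C) (u v : C) : a @ G --> u -> b @ G --> v ->
  a t + b t @[t --> G] --> u + v by exact: cvgD.
have sqrW (a : T -> C) (u : C) : a @ G --> u -> a t ^+ 2 @[t --> G] --> u ^+ 2.
  by move=> au; exact: cvgM.
have oppW (a : T -> C) (u : C) : a @ G --> u -> - a t @[t --> G] --> - u.
  by exact: cvgN.
have invW (a : T -> C) (u : C) : u != 0 -> a @ G --> u ->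
    (a t)^-1 @[t --> G] --> u^-1.
  by exact: cvgV.
have nz n : 1 - q ^+ n * 0 != 0 :> C by rewrite mulr0 subr0 oner_eq0.
have cst (a : C) : a @[t --> G] --> a by exact: cvg_cst.
have D n : (1 - q ^+ n * f t)^-1 @[t --> G] --> (1 - q ^+ n * 0)^-1.
  apply: invW => //; apply: (addW (fun=> _)) => //.
  by apply: oppW; apply: (mulW (fun=> _)).
have D2 : ((1 - q ^+ 2 * f t) * (1 - q ^+ 3 * f t))^-1 @[t --> G] -->
          ((1 - q ^+ 2 * 0) * (1 - q ^+ 3 * 0))^-1.
  by rewrite invfM; under eq_fun do rewrite invfM; exact: mulW.
rewrite /ik_weight.
case: i => [|[|[|i]]]; try exact: cst; case: j => [|[|[|j]]]; try exact: cst;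
case: k => [|[|[|k]]]; try exact: cst; case: l => [|[|[|l]]]; try exact: cst.
all: by repeat lazymatch goal with
  | |- (fun t => @?a t * @?b t) @ _ --> _ => apply: (mulW)
  | |- (fun t => @?a t + @?b t) @ _ --> _ => apply: (addW)
  | |- (fun t => - @?a t) @ _ --> _ => apply: (oppW)
  | |- (fun t => (@?a t)^-1) @ _ --> _ => first [exact: D2 | exact: D]
  | |- (fun t => @?a t ^+ 2) @ _ --> _ => first [exact: cst | apply: (sqrW)]
  | |- _ => first [exact: cst | exact: f0]
  end.
Qed.

Lemma cvg_ik_weight (C : numFieldType) (q y : C) (i j k l : nat) :
  ik_weight q t y i j k l @[t --> infty_nbhs C] --> ik_weight q 1 0 i j k l.
Proof.
have c0 : y * t^-1 @[t --> infty_nbhs C] --> 0.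
  rewrite -[X in _ --> X](mulr0 y).
  by apply: cvgM; [exact: cvg_cst | exact: cvg_inv_infty].
apply: cvg_trans (cvg_ik_weight0 _ c0); apply: near_eq_cvg.
exists 0; split=> // t /[!normr_gt0] t0.
by rewrite -(ik_weight_scale _ _ _ _ _ _ _ t0) mulr1 mulrCA divff ?mulr1.
Qed.

(** * Sums and matrices *)

(** A sum over [B] whose nonzero terms all lie in the image of [e : A -> B],
    with partial inverse [r], is a sum over [A]. *)
Lemma sum_retract (R : nmodType) (A B : finType) (e : A -> B) (r : B -> A)
    (P : pred B) (Q : pred A) (f : B -> R) (g : A -> R) :
  (forall b, P b -> f b != 0 -> e (r b) = b /\ Q (r b)) ->
  (forall a, Q a -> [/\ r (e a) = a, P (e a) & f (e a) = g a]) ->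
  \sum_(b | P b) f b = \sum_(a | Q a) g a.
Proof.
move=> suppf eQ; pose P' b := [&& P b, Q (r b) & e (r b) == b].
transitivity (\sum_(b | P' b) f b).
  rewrite big_mkcond [RHS]big_mkcond; apply: eq_bigr => b _; rewrite /P'.
  have [Pb|//] := boolP (P b).
  have [->|fb0] := eqVneq (f b) 0; first by case: ifP.
  by have [-> ->] := suppf b Pb fb0; rewrite eqxx.
rewrite (reindex_onto e r) => [|b /and3P[_ _ /eqP//]].
apply: eq_big => [a|a /andP[/and3P[_ Q' _] /eqP ra]].
  apply/andP/idP => [[/and3P[_ Qa _] /eqP ra]|Qa]; first by rewrite ra in Qa.
  by have [ra Pe _] := eQ a Qa; rewrite /P' ra Pe Qa !eqxx.
by rewrite ra in Q'; have [] := eQ a Q'.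
Qed.

Lemma widen_lift_max n (i : 'I_n) : widen_ord (leqnSn n) i = lift ord_max i.
Proof. by apply: val_inj; rewrite /= /bump leqNgt ltn_ord. Qed.

Lemma lift0_widen n (i : 'I_n) :
  lift ord0 (widen_ord (leqnSn n) i) = widen_ord (leqnSn n.+1) (lift ord0 i).
Proof. exact: val_inj. Qed.

Lemma lift0_max n : lift ord0 (@ord_max n) = ord_max.
Proof. exact: val_inj. Qed.

(** A nondecreasing sequence of naturals that ends with 0 vanishes. *)
Lemma ndecr_ord_eq0 L (g : 'I_L.+1 -> nat) :
  (forall c : 'I_L, g (widen_ord (leqnSn L) c) <= g (lift ord0 c))%N ->
  g ord_max = 0%N -> forall c, g c = 0%N.
Proof.
move=> gle gL c; have [k] := ubnP (L - c)%N.
elim: k c => // k IH c ck; have [Lc|cL] := leqP L c.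
  by rewrite (_ : c = ord_max) //; apply/val_inj/anti_leq;
    rewrite /= Lc -ltnS ltn_ord.
have := gle (Ordinal cL); rewrite (_ : widen_ord _ _ = c); last exact: val_inj.
by rewrite (IH (lift ord0 _)) ?leqn0 => [/eqP //|]; rewrite /= /bump; lia.
Qed.

(** [row_snoc A w] is [A] with [w] appended as last row. *)
Definition row_snoc (T : Type) n m (A : 'M[T]_(n, m)) (w : 'I_m -> T) :
    'M[T]_(n.+1, m) :=
  \matrix_(i, j) if unlift ord_max i is Some i' then A i' j else w j.

(** [col_snoc A w] is [A] with [w] appended as last column. *)
Definition col_snoc (T : Type) n m (A : 'M[T]_(n, m)) (w : 'I_n -> T) :
    'M[T]_(n, m.+1) :=
  \matrix_(i, j) if unlift ord_max j is Some j' then A i j' else w i.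

Section Snoc.
Variables (T : Type) (n m : nat).

Lemma row_snoc_widen (A : 'M[T]_(n, m)) w i j :
  row_snoc A w (widen_ord (leqnSn n) i) j = A i j.
Proof. by rewrite mxE widen_lift_max liftK. Qed.

Lemma row_snoc_max (A : 'M[T]_(n, m)) w j : row_snoc A w ord_max j = w j.
Proof. by rewrite mxE unlift_none. Qed.

Lemma row_snocK (A : 'M[T]_(n, m)) w : row' ord_max (row_snoc A w) = A.
Proof. by apply/matrixP => i j; rewrite !mxE liftK. Qed.

Lemma row'_snoc (A : 'M[T]_(n.+1, m)) w :
  (forall j, A ord_max j = w j) -> row_snoc (row' ord_max A) w = A.
Proof.
by move=> Aw; apply/matrixP => i j; rewrite !mxE; case: unliftP => [i'|] ->;
  rewrite ?mxE.
Qed.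

Lemma col_snoc_widen (A : 'M[T]_(n, m)) w i j :
  col_snoc A w i (widen_ord (leqnSn m) j) = A i j.
Proof. by rewrite mxE widen_lift_max liftK. Qed.

Lemma col_snoc_max (A : 'M[T]_(n, m)) w i : col_snoc A w i ord_max = w i.
Proof. by rewrite mxE unlift_none. Qed.

Lemma col_snocK (A : 'M[T]_(n, m)) w : col' ord_max (col_snoc A w) = A.
Proof. by apply/matrixP => i j; rewrite !mxE liftK. Qed.

Lemma col'_snoc (A : 'M[T]_(n, m.+1)) w :
  (forall i, A i ord_max = w i) -> col_snoc (col' ord_max A) w = A.
Proof.
by move=> Aw; apply/matrixP => i j; rewrite !mxE; case: unliftP => [j'|] ->;
  rewrite ?mxE.
Qed.

End Snoc.

Lemma ord0_widen n : (ord0 : 'I_n.+2) = widen_ord (leqnSn n.+1) ord0.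
Proof. exact: val_inj. Qed.

(** * Removing a row or a column of the lattice *)

(** The sum defining [ik_F], with an arbitrary weight [W r c] at each vertex. *)
Definition partition_fun (F : fieldType) (N L : nat)
    (W : 'I_N -> 'I_L -> nat -> nat -> nat -> nat -> F)
    (S : nat -> 'I_3) (I : 'I_N -> 'I_3) : F :=
  \sum_(h : 'M['I_3]_(N, L.+1) |
      [forall r, (h r ord0 == I r) && (h r ord_max == ord0)])
  \sum_(v : 'M['I_3]_(N.+1, L) |
      [forall c : 'I_L, (v ord0 c == ord0) && (v ord_max c == S c)])
    \prod_(r < N) \prod_(c < L)
      W r c
        (v (widen_ord (leqnSn N) r) c) (h r (widen_ord (leqnSn L) c))
        (v (lift ord0 r) c) (h r (lift ord0 c)).

(** A row with nonzero limit weights and right end 0 carries only 0 on its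
    horizontal edges, and the same states below ([u]) and above ([v]). *)
Lemma row_inf_frozen (F : fieldType) (q : F) L (u v : 'I_L -> 'I_3)
    (h : 'I_L.+1 -> 'I_3) :
  (forall c, ik_weight q 1 0 (u c) (h (widen_ord (leqnSn L) c))
               (v c) (h (lift ord0 c)) != 0) ->
  h ord_max = ord0 -> (forall c, h c = ord0) /\ (forall c, u c = v c).
Proof.
move=> W0 hmax.
have h0 c : h c = ord0.
  apply: val_inj; apply: (ndecr_ord_eq0 (g := fun c => h c)) => [c'|].
    exact: ik_weight_inf_ndecr (W0 c').
  by rewrite hmax.
split=> // c; apply: val_inj; have := ik_weight_conserve (W0 c).
by rewrite !h0 !addn0.
Qed.

Section LastRow.
Variables (F : fieldType) (q : F) (n L : nat).
Variables (W : 'I_n.+1 -> 'I_L -> nat -> nat -> nat -> nat -> F).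
Variables (S : nat -> 'I_3) (I : 'I_n.+1 -> 'I_3).
Hypothesis Wmax : forall c, W ord_max c = ik_weight q 1 0.

Lemma partition_fun_row_inf0 : I ord_max != ord0 -> partition_fun W S I = 0.
Proof.
move=> I0; rewrite /partition_fun big1 // => h /forallP hP.
rewrite big1 // => v _.
apply/eqP; apply: contraNT I0; rewrite big_ord_recr /= mulf_eq0 negb_or.
move=> /andP[_ /prodf_neq0 W0].
have /andP[/eqP <- /eqP hmax] := hP ord_max.
have [|-> //] := row_inf_frozen (u := v (widen_ord (leqnSn n.+1) ord_max))
  (v := v (lift ord0 ord_max)) (q := q) _ hmax.
by move=> c; rewrite -(Wmax c); exact: W0.
Qed.

(** Removing a top row with infinite parameter and left boundary 0. *)
Lemma partition_fun_row_inf : I ord_max = ord0 ->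
  partition_fun W S I = q ^+ (2 * \sum_(c < L) S c) *
    partition_fun (fun r => W (widen_ord (leqnSn n) r)) S
                  (fun r => I (widen_ord (leqnSn n) r)).
Proof.
move=> I0; rewrite /partition_fun mulr_sumr.
under [RHS]eq_bigr do rewrite mulr_sumr.
rewrite !pair_big /=.
apply: (sum_retract
  (e := fun p => (row_snoc p.1 (fun=> ord0), row_snoc p.2 (fun c => S c)))
  (r := fun p => (row' ord_max p.1, row' ord_max p.2))).
- move=> [h v] /= /andP[/forallP hP /forallP vP].
  rewrite big_ord_recr /= mulf_eq0 negb_or => /andP[_ /prodf_neq0 W0].
  have /andP[_ /eqP hmax] := hP ord_max.
  have [|h0 uv] := row_inf_frozen (u := v (widen_ord (leqnSn n.+1) ord_max))
    (v := v (lift ord0 ord_max)) (q := q) _ hmax.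
    by move=> c; rewrite -(Wmax c); exact: W0.
  split.
    rewrite !row'_snoc // => c.
    by have /andP[_ /eqP] := vP c.
  apply/andP; split; apply/forallP => r.
    by rewrite !mxE -widen_lift_max.
  rewrite !mxE -!widen_lift_max -ord0_widen uv lift0_max; exact: vP.
- move=> [h v] /= /andP[/forallP hP /forallP vP]; split.
  + by rewrite !row_snocK.
  + apply/andP; split; apply/forallP => r.
      have [r' ->|->] := unliftP ord_max r; last by rewrite !row_snoc_max I0.
      by rewrite -widen_lift_max !row_snoc_widen.
    rewrite (ord0_widen n) row_snoc_widen row_snoc_max eqxx.
    by have /andP[->] := vP r.
  + rewrite big_ord_recr /= mulrC; congr (_ * _).
      rewrite big_distrr expr_sum; apply: eq_bigr => c _.
      have /andP[_ /eqP vS] := vP c.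
      rewrite Wmax row_snoc_widen lift0_max !row_snoc_max vS.
      exact: ik_weight_inf_vert.
    apply: eq_bigr => r _; apply: eq_bigr => c _.
    by rewrite lift0_widen !row_snoc_widen.
Qed.

End LastRow.

(** A last column on top of which [S] is 0 can be removed: its right edges are
    0, so by conservation its vertical states do not decrease upwards, and they
    end with 0. *)
Lemma partition_fun_col0 (F : fieldType) (N L : nat)
    (W : 'I_N -> 'I_L.+1 -> nat -> nat -> nat -> nat -> F)
    (S : nat -> 'I_3) (I : 'I_N -> 'I_3) :
  (forall r i j k l, W r ord_max i j k l != 0 -> (i + j = k + l)%N) ->
  (forall r, W r ord_max 0%N 0%N 0%N 0%N = 1) ->
  S L = ord0 ->
  partition_fun W S I =
    partition_fun (fun r c => W r (widen_ord (leqnSn L) c)) S I.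
Proof.
move=> Wc W1 SL; rewrite /partition_fun !pair_big /=.
apply: (sum_retract
  (e := fun p => (col_snoc p.1 (fun=> ord0), col_snoc p.2 (fun=> ord0)))
  (r := fun p => (col' ord_max p.1, col' ord_max p.2))).
- move=> [h v] /= /andP[/forallP hP /forallP vP] W0.
  have {}W0 r : W r ord_max (v (widen_ord (leqnSn N) r) ord_max)
      (h r (widen_ord (leqnSn L.+1) ord_max)) (v (lift ord0 r) ord_max)
      (h r (lift ord0 ord_max)) != 0.
    by move/prodf_neq0: W0 => /(_ r isT) /prodf_neq0 /(_ ord_max isT).
  have cons r : (v (widen_ord (leqnSn N) r) ord_max +
      h r (widen_ord (leqnSn L.+1) ord_max) = v (lift ord0 r) ord_max)%N.
    have := Wc _ _ _ _ _ (W0 r); rewrite lift0_max.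
    by have /andP[_ /eqP ->] := hP r; rewrite addn0.
  have v0 r : v r ord_max = ord0.
    apply: val_inj; apply: (ndecr_ord_eq0 (g := fun r => v r ord_max)) => [r'|].
      by rewrite -cons leq_addr.
    by have /andP[_ /eqP ->] := vP ord_max; rewrite SL.
  have h0 r : h r (widen_ord (leqnSn L.+1) ord_max) = ord0.
    by apply: val_inj; have := cons r; rewrite !v0.
  split.
    by rewrite !col'_snoc // => r; have /andP[_ /eqP] := hP r.
  apply/andP; split; apply/forallP => r; rewrite !mxE -!widen_lift_max.
    by rewrite -ord0_widen h0 eqxx andbT; have /andP[] := hP r.
  exact: vP.
- move=> [h v] /= /andP[/forallP hP /forallP vP]; split.
  + by rewrite !col_snocK.
  + apply/andP; split; apply/forallP => r.
      rewrite (ord0_widen L) col_snoc_widen col_snoc_max eqxx.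
      by have /andP[->] := hP r.
    have [r' ->|->] := unliftP ord_max r; last by rewrite !col_snoc_max SL.
    by rewrite -widen_lift_max !col_snoc_widen.
  + apply: eq_bigr => r _; rewrite big_ord_recr /= -[RHS]mulr1; congr (_ * _).
      by apply: eq_bigr => c _; rewrite lift0_widen !col_snoc_widen.
    rewrite col_snoc_widen lift0_max !col_snoc_max.
    by have /andP[_ /eqP ->] := hP r.
Qed.

(** * Independence of the number of columns *)

Lemma ik_F_partition_fun (F : fieldType) (q : F) (z : nat -> F) (L N : nat)
    (S : two_string) (I : N.-tuple 'I_3) (x : N.-tuple F) :
  ik_F q z L S I x =
  partition_fun (fun r (c : 'I_L) => ik_weight q (tnth x r) (z c)) S (tnth I).
Proof. by []. Qed.

Lemma ik_F_addL (F : fieldType) (q : F) (z : nat -> F) (L N k : nat)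
    (S : two_string) (I : N.-tuple 'I_3) (x : N.-tuple F) :
  ts_fits S L -> ik_F q z (k + L) S I x = ik_F q z L S I x.
Proof.
move=> SL; elim: k => // k <-; rewrite !ik_F_partition_fun addSn.
apply: partition_fun_col0 => [r i j a l|//|]; first exact: ik_weight_conserve.
by rewrite SL ?leq_addl.
Qed.

Lemma ik_F_indep (F : fieldType) (q : F) (z : nat -> F) (L L' N : nat)
    (S : two_string) (I : N.-tuple 'I_3) (x : N.-tuple F) :
  ts_fits S L -> ts_fits S L' -> ik_F q z L S I x = ik_F q z L' S I x.
Proof.
by move=> SL SL'; rewrite -(ik_F_addL _ _ L' _ _ SL) addnC ik_F_addL.
Qed.

Lemma ik_H_indep (F : fieldType) (q : F) (z : nat -> F) (L L' N : nat)
    (S : two_string) (x : N.-tuple F) :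
  ts_fits S L -> ts_fits S L' -> ik_H q z L S x = ik_H q z L' S x.
Proof.
by move=> SL SL'; apply: eq_bigr => I _; rewrite (ik_F_indep _ _ _ _ SL SL').
Qed.

(** * Appending a 0 to the left boundary state *)

Section Rcons.
Variables (T : Type) (n : nat).

Lemma tnth_rcons_widen (I : n.-tuple T) (a : T) (i : 'I_n) :
  tnth (rcons_tuple I a) (widen_ord (leqnSn n) i) = tnth I i.
Proof. by rewrite !(tnth_nth a) /= nth_rcons size_tuple ltn_ord. Qed.

Lemma tnth_rcons_max (I : n.-tuple T) (a : T) :
  tnth (rcons_tuple I a) ord_max = a.
Proof. by rewrite (tnth_nth a) /= nth_rcons size_tuple ltnn eqxx. Qed.

End Rcons.

Section RconsState.
Variables (n : nat) (I : n.-tuple 'I_3).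
Let J := rcons_tuple I ord0.

Lemma state_size_rcons0 : state_size J = state_size I.
Proof.
rewrite /state_size big_ord_recr /= tnth_rcons_max addn0.
by apply: eq_bigr => i _; rewrite tnth_rcons_widen.
Qed.

Lemma state_c1_rcons0 : state_c1 J = state_c1 I.
Proof.
rewrite /state_c1 -!sum1_card big_mkcond big_ord_recr /= !inE tnth_rcons_max.
rewrite addn0 [RHS]big_mkcond; apply: eq_bigr => i _.
by rewrite !inE tnth_rcons_widen.
Qed.

(** The new 0 forms an inversion of weight [2 * I_i] with every entry [I_i]. *)
Lemma state_inv_rcons0 : state_inv J = (state_inv I + 2 * state_size I)%N.
Proof.
rewrite /state_inv big_ord_recr /= [X in (_ + X)%N]big1 => [|j]; last first.
  by rewrite tnth_rcons_max mul0n.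
rewrite addn0 /state_size big_distrr -big_split; apply: eq_bigr => i _ /=.
rewrite big_mkcond big_ord_recr /= ltn_ord tnth_rcons_max tnth_rcons_widen.
rewrite subn0 mulnC [in RHS]big_mkcond; congr (_ + _)%N.
by apply: eq_bigr => j _; rewrite tnth_rcons_widen.
Qed.

End RconsState.

(** * The limit *)

Lemma state_size_le n (I : n.-tuple 'I_3) : (state_size I <= 2 * n)%N.
Proof.
rewrite mulnC -[n in (n * _)%N]card_ord -sum_nat_const.
by apply: leq_sum => i _; rewrite -ltnS ltn_ord.
Qed.

Lemma ik_H_eq0 (F : fieldType) (q : F) (z : nat -> F) (L N : nat)
    (S : two_string) (x : N.-tuple F) :
  (2 * N < ts_size S)%N -> ik_H q z L S x = 0.
Proof.
move=> NS; rewrite /ik_H big_pred0 // => I; apply: contraTF NS => /eqP <-.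
by rewrite -leqNgt state_size_le.
Qed.

Lemma ts_sizeE (S : two_string) (L : nat) :
  ts_fits S L -> ts_size S = (\sum_(c < L) S c)%N.
Proof.
move=> SL; rewrite -(big_mkord xpredT (fun c => S c : nat)) /ts_size.
rewrite [RHS](bigID [in finsupp S]) /= [X in (_ + X)%N]big1 => [|c].
  rewrite addn0 -[RHS]big_filter; apply: perm_big; apply: uniq_perm.
  - exact: fset_uniq.
  - by rewrite filter_uniq ?iota_uniq.
  - move=> c; rewrite mem_filter mem_index_iota /=.
    case: (boolP (c \in finsupp S)) => //= cS; apply/esym.
    by rewrite ltnNge; apply: contraTN cS => /SL Sc; rewrite memNfinsupp Sc.
by rewrite memNfinsupp => /eqP ->.
Qed.

(** [ik_F] with [n.+1] rows, the parameter of the top row being infinite. *)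
Definition ik_F_inf (F : fieldType) (q : F) (z : nat -> F) (L n : nat)
    (S : two_string) (I : n.+1.-tuple 'I_3) (x : n.-tuple F) : F :=
  partition_fun (fun r (c : 'I_L) =>
      if unlift ord_max r is Some r' then ik_weight q (tnth x r') (z c)
      else ik_weight q 1 0) S (tnth I).

Lemma cvg_ik_F (C : numFieldType) (q : C) (z : nat -> C) (L n : nat)
    (S : two_string) (I : n.+1.-tuple 'I_3) (x : n.-tuple C) :
  ik_F q z L S I (rcons_tuple x t) @[t --> infty_nbhs C] -->
    ik_F_inf q z L S I x.
Proof.
apply: cvg_big => [|h _]; first exact: add_continuous.
apply: cvg_big => [|v _]; first exact: add_continuous.
apply: cvg_big => [|r _]; first exact: mul_continuous.
apply: cvg_big => [|c _]; first exact: mul_continuous.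
have [r' ->|->] := unliftP ord_max r.
  rewrite -widen_lift_max.
  by under eq_fun do rewrite tnth_rcons_widen; exact: cvg_cst.
by under eq_fun do rewrite tnth_rcons_max; exact: cvg_ik_weight.
Qed.

Lemma ik_F_inf_rcons0 (F : fieldType) (q : F) (z : nat -> F) (L n : nat)
    (S : two_string) (I : n.-tuple 'I_3) (x : n.-tuple F) :
  ts_fits S L ->
  ik_F_inf q z L S (rcons_tuple I ord0) x =
    q ^+ (2 * ts_size S) * ik_F q z L S I x.
Proof.
move=> SL; rewrite /ik_F_inf (partition_fun_row_inf (q := q)); first last.
- exact: tnth_rcons_max.
- by move=> c; rewrite unlift_none.
rewrite -ts_sizeE // ik_F_partition_fun; congr (_ * partition_fun _ _ _).
  by apply/funext => r; rewrite widen_lift_max liftK.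
by apply/funext => r; rewrite tnth_rcons_widen.
Qed.

Lemma ik_F_inf_eq0 (F : fieldType) (q : F) (z : nat -> F) (L n : nat)
    (S : two_string) (I : n.+1.-tuple 'I_3) (x : n.-tuple F) :
  tnth I ord_max != ord0 -> ik_F_inf q z L S I x = 0.
Proof.
by apply: (partition_fun_row_inf0 (q := q)) => c; rewrite unlift_none.
Qed.

Lemma cvg_ik_H (C : numFieldType) (q : C) (z : nat -> C) (L n : nat)
    (S : two_string) (x : n.-tuple C) :
  q != 0 -> ts_fits S L ->
  ik_H q z L S (rcons_tuple x t) @[t --> infty_nbhs C] --> ik_H q z L S x.
Proof.
move=> q0 SL.
pose coef m (I : m.-tuple 'I_3) : C :=
  (-1) ^+ (state_c1 I)./2 * (1 - q^-1) ^+ state_c1 I * q ^- state_inv I.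
have -> : ik_H q z L S x =
    \sum_(I : n.+1.-tuple 'I_3 | state_size I == ts_size S)
       coef _ I * ik_F_inf q z L S I x.
  apply/esym; apply: (sum_retract (e := fun I => rcons_tuple I ord0)
    (r := fun I => [tuple tnth I (widen_ord (leqnSn n) i) | i < n])).
  - move=> I /eqP sI; rewrite mulf_eq0 negb_or => /andP[_ F0].
    have I0 : tnth I ord_max = ord0.
      by apply: contraNeq F0 => /ik_F_inf_eq0 ->.
    set I' := [tuple _ | i < n].
    have eI : rcons_tuple I' ord0 = I.
      apply: eq_from_tnth => i; have [i' ->|->] := unliftP ord_max i.
        by rewrite -widen_lift_max tnth_rcons_widen tnth_mktuple.
      by rewrite tnth_rcons_max I0.
    by split=> //; rewrite -state_size_rcons0 eI sI.
  - move=> I /eqP sI; split; last 1 first.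
    (* The factor [q ^+ (2 * |S|)] of the top row cancels the change of the
       inversion number. *)
    + rewrite /coef state_c1_rcons0 state_inv_rcons0 ik_F_inf_rcons0 // sI.
      by rewrite exprD invfM !mulrA mulfVK // expf_neq0.
    + by apply: eq_from_tnth => i; rewrite tnth_mktuple tnth_rcons_widen.
    + by rewrite state_size_rcons0 sI.
apply: cvg_big => [|I _]; first exact: add_continuous.
by apply: cvgM; [exact: cvg_cst | exact: cvg_ik_F].
Qed.

Theorem proposition1p7p3 (C : numFieldType) (N K : nat)
    (hN : (1 <= N)%N) (hK : (K <= N)%N)
    (S : two_string) (hS : ts_size S = (2 * K)%N)
    (L L' : nat) (hL : ts_fits S L) (hL' : ts_fits S L')
    (q : C) (z : nat -> C) (x : N.-1.-tuple C)
    (hq : q != 0)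
    (hx : forall (r : 'I_N.-1) (c : nat),
       tnth x r - q ^+ 2 * z c != 0 /\ tnth x r - q ^+ 3 * z c != 0) :
  ik_H q z L S (rcons_tuple x t) @[t --> infty_nbhs C] -->
    (if (ts_size S <= 2 * N - 2)%N then ik_H q z L' S x else 0 : C).
Proof.
case: N hN x {hK hx} => // n _ /= x.
have -> : (2 * n.+1 - 2 = 2 * n)%N by lia.
rewrite (ik_H_indep _ _ _ hL' hL); case: leqP => [_|/(ik_H_eq0 q z L x) <-];
  exact: cvg_ik_H.
Qed.
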